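(* Consider the Singleton Search Engine Game with $\beta=1$ and a symmetric and strictly cross-concave selection rule $f$. Let $\mathbf Q=(\mathbf q_i)_{i=1}^K$ be a pure strategy (Nash) equilibrium of this game. Then $\mathbf Q$ must be symmetric, i.e., $\mathbf q_i=\mathbf q_{i'}$ for all engines $i,i'$.
   Context: Selection rule: a map $f:[0,1]^K\to$ (probability distributions on the $K$ engines), where $f_i(\mathbf q)$ is the probability that a user with satisfaction probabilities $\mathbf q=(q_1,\dots,q_K)$ selects engine $i$; $f_i$ is non-decreasing in $q_i$ and non-increasing in $q_{i'}$ for each $i'\ne i$. $f$ is symmetric if it is invariant under relabeling of the engines; then one writes $f(\mathbf q)=f_1(\mathbf q)$, which fully specifies the rule (the first argument is the satisfaction probability of the engine whose selection probability is considered). A symmetric $f$ is strictly cross-concave if for all $x<y$ in $[0,1]$ and all $\mathbf q_{-\{1,2\}}\in[0,1]^{K-2}$ (satisfaction probabilities of the engines other than two given ones) there exists $\delta>0$ such that for all $0<\epsilon<\delta$, $$f(x+\epsilon,y,\mathbf q_{-\{1,2\}})-f(x,y,\mathbf q_{-\{1,2\}})>f(y,x,\mathbf q_{-\{1,2\}})-f(y-\epsilon,x,\mathbf q_{-\{1,2\}}).$$ Singleton Search Engine Game: there are $K$ engines, $N$ pages $\{1,\dots,N\}$, and a probability distribution $\gamma$ on pages with $\gamma(n)>0$ for all $n$; a user of type $n$ (probability $\gamma(n)$) desires exactly page $n$ and looks only at the first displayed page. A pure strategy of engine $i$ is a probability vector $\mathbf q_i=(q_i(n))_{n=1}^N$,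 where $q_i(n)$ is the probability of displaying page $n$. With $\mathbf q(n)=(q_1(n),\dots,q_K(n))$ and parameter $\beta\in[0,1]$, engine $i$'s payoff is $\sum_n\gamma(n)f_i(\mathbf q(n))(\beta+(1-\beta)q_i(n))$; for $\beta=1$ it is $\sum_n\gamma(n)f_i(\mathbf q(n))$. A pure Nash equilibrium is a profile of pure strategies from which no engine can strictly improve her payoff by a unilateral deviation to another pure strategy. *)

(* Defs.v *)
From mathcomp Require Import all_boot all_order all_algebra all_fingroup.
From mathcomp Require Import reals.

Set Implicit Arguments.
Unset Strict Implicit.
Unset Printing Implicit Defensive.

Import Order.TTheory GRing.Theory Num.Theory.
Local Open Scope ring_scope.

Definition distribution (R : realType) (T : finType) (p : {ffun T -> R}) : Prop :=
  (forall t, 0 <= p t) /\ \sum_t p t = 1.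

Definition in_cube (R : realType) (K : nat) (q : {ffun 'I_K -> R}) : Prop :=
  forall i, 0 <= q i <= 1.

(* A map on the cube [0,1]^K is represented by a total function on R^K; only
   its values on the cube are constrained or used. [f q i] is f_i(q). *)
Record selection_rule (R : realType) (K : nat)
    (f : {ffun 'I_K -> R} -> {ffun 'I_K -> R}) : Prop := SelectionRule {
  selection_distribution : forall q, in_cube q -> distribution (f q);
  selection_nondecreasing : forall (q q' : {ffun 'I_K -> R}) (i : 'I_K),
    in_cube q -> in_cube q' -> (forall j, j != i -> q j = q' j) ->
    q i <= q' i -> f q i <= f q' i;
  selection_nonincreasing : forall (q q' : {ffun 'I_K -> R}) (i i' : 'I_K),
    i' != i ->
    in_cube q -> in_cube q' -> (forall j, j != i' -> q j = q' j) ->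
    q i' <= q' i' -> f q' i <= f q i
}.

Definition symmetric_rule (R : realType) (K : nat)
    (f : {ffun 'I_K -> R} -> {ffun 'I_K -> R}) : Prop :=
  forall (s : 'S_K) (q : {ffun 'I_K -> R}) (i : 'I_K),
    in_cube q -> f [ffun j => q (s j)] i = f q (s i).

(* The vector (x, y, q_{-{a,b}}), with x at index a and y at index b; the
   entries of q at a and b are ignored. *)
Definition with_pair (R : realType) (K : nat) (a b : 'I_K) (x y : R)
    (q : {ffun 'I_K -> R}) : {ffun 'I_K -> R} :=
  [ffun i => if i == a then x else if i == b then y else q i].

(* Here a and b are the first and second engines (of indices 0 and 1), and
   f(x, y, q_{-{1,2}}) stands for f_1 evaluated at that vector, which fully
   specifies a symmetric f. Since delta may always be decreased, the values of
   f outside the cube (when x + e > 1 or y - e < 0) play no role. *)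
Definition strictly_cross_concave (R : realType) (K : nat)
    (f : {ffun 'I_K -> R} -> {ffun 'I_K -> R}) : Prop :=
  forall (a b : 'I_K), a = 0%N :> nat -> b = 1%N :> nat ->
  forall (x y : R) (q : {ffun 'I_K -> R}),
    0 <= x <= 1 -> 0 <= y <= 1 -> x < y -> in_cube q ->
  exists2 delta : R, 0 < delta &
    forall e : R, 0 < e < delta ->
      f (with_pair a b (x + e) y q) a - f (with_pair a b x y q) a >
      f (with_pair a b y x q) a - f (with_pair a b (y - e) x q) a.

Definition satisfaction (R : realType) (K N : nat)
    (Q : 'I_K -> {ffun 'I_N -> R}) (n : 'I_N) : {ffun 'I_K -> R} :=
  [ffun i => Q i n].

Definition payoff (R : realType) (K N : nat) (gamma : {ffun 'I_N -> R})
    (f : {ffun 'I_K -> R} -> {ffun 'I_K -> R}) (beta : R)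
    (Q : 'I_K -> {ffun 'I_N -> R}) (i : 'I_K) : R :=
  \sum_n gamma n * f (satisfaction Q n) i * (beta + (1 - beta) * Q i n).

Definition pure_nash_equilibrium (R : realType) (K N : nat)
    (gamma : {ffun 'I_N -> R}) (f : {ffun 'I_K -> R} -> {ffun 'I_K -> R})
    (beta : R) (Q : 'I_K -> {ffun 'I_N -> R}) : Prop :=
  (forall i, distribution (Q i)) /\
  (forall (i : 'I_K) (q : {ffun 'I_N -> R}), distribution q ->
     payoff gamma f beta [eta Q with i |-> q] i <= payoff gamma f beta Q i).

(* Main.v *)
(* If q_i <> q_j, then, both vectors summing to 1, there are pages n and m with
   q_i(n) < q_j(n) and q_j(m) < q_i(m). Let engine i move a small mass e from m
   to n, and engine j a mass e from n to m. Write A_n for the gain of the lower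
   of the two engines on page n when it rises by e, B_n for the loss of the
   higher one when it falls by e, and similarly on m. Equilibrium gives
   gamma(n) A_n <= gamma(m) B_m and gamma(m) A_m <= gamma(n) B_n, while
   cross-concavity gives B_n < A_n and B_m < A_m: a contradiction. *)
Require Import Defs.
From mathcomp Require Import all_boot all_order all_algebra all_fingroup.
From mathcomp Require Import reals lra.

Set Implicit Arguments.
Unset Strict Implicit.
Unset Printing Implicit Defensive.

Import Order.TTheory GRing.Theory Num.Theory.
Local Open Scope ring_scope.

(** Serves to carry cross-concavity, stated for engines 0 and 1 only, to any two engines. A first
    transposition sends [a] to [i]; a second sends the image of [b] to [j] and fixes [i]. *)
Lemma perm_of_pair (T : finType) (a b i j : T) :
  a != b -> i != j -> exists2 s : {perm T}, s a = i & s b = j.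
Proof.
move=> ab ij; exists (tperm a i * tperm (tperm a i b) j)%g; last first.
  by rewrite permM tpermL.
rewrite permM tpermL tpermD //; last by rewrite eq_sym.
by rewrite -[X in _ != X](tpermL a i) (inj_eq perm_inj) eq_sym.
Qed.

Lemma distribution_le1 (R : realType) (T : finType) (p : {ffun T -> R}) (t : T) :
  distribution p -> p t <= 1.
Proof.
case=> p0 <-; rewrite (bigD1 t) //= lerDl.
by apply: sumr_ge0 => u _; apply: p0.
Qed.

(** Otherwise the differences [p u - q u] are nonnegative with sum 0, so all vanish. *)
Lemma distribution_ltP (R : realType) (T : finType) (p q : {ffun T -> R}) :
  distribution p -> distribution q -> p <> q -> exists t, p t < q t.
Proof.
move=> [_ p1] [_ q1] pq; apply/existsP; apply: contra_notT pq.
rewrite negb_exists => /forallP le_qp; apply/ffunP => t.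
have ge0 u : 0 <= p u - q u by rewrite subr_ge0 leNgt.
have /eqP : \sum_u (p u - q u) = 0 by rewrite sumrB p1 q1 subrr.
rewrite psumr_eq0; last by move=> u _; apply: ge0.
by move/allP/(_ t (mem_index_enum t)); rewrite subr_eq0 => /eqP.
Qed.

Definition transfer (R : realType) (T : finType) (p : {ffun T -> R})
    (n m : T) (e : R) : {ffun T -> R} :=
  [ffun t => if t == n then p n + e else if t == m then p m - e else p t].

Lemma transfer_distribution (R : realType) (T : finType) (p : {ffun T -> R})
    (n m : T) (e : R) :
  m != n -> 0 <= e <= p m -> distribution p ->
  distribution (transfer p n m e).
Proof.
move=> mn /andP[e0 em] [p0 p1]; split=> [t|].
  by rewrite ffunE; case: eqP => _; [apply: addr_ge0|case: eqP; rewrite ?subr_ge0].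
rewrite -p1 (bigD1 n) //= (bigD1 m) //= [RHS](bigD1 n) //= [in RHS](bigD1 m) //=.
rewrite !ffunE !eqxx (negPf mn) [X in _ + (_ + X) = _](eq_bigr p); first lra.
by move=> t /andP[/negPf tn /negPf tm]; rewrite ffunE tn tm.
Qed.

Section Rule.
Variables (R : realType) (K : nat) (f : {ffun 'I_K -> R} -> {ffun 'I_K -> R}).

Lemma with_pair_cube (i j : 'I_K) (x y : R) (q : {ffun 'I_K -> R}) :
  0 <= x <= 1 -> 0 <= y <= 1 -> in_cube q -> in_cube (with_pair i j x y q).
Proof. by move=> xP yP qP k; rewrite ffunE; do 2![case: eqP => // _]. Qed.

Lemma symmetric_with_pair (s : 'S_K) (a b : 'I_K) (x y : R)
    (q : {ffun 'I_K -> R}) :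
  symmetric_rule f -> 0 <= x <= 1 -> 0 <= y <= 1 -> in_cube q ->
  f (with_pair a b x y [ffun k => q (s k)]) a =
  f (with_pair (s a) (s b) x y q) (s a).
Proof.
move=> symf xP yP qP; rewrite -symf; last exact: with_pair_cube.
by congr (f _ a); apply/ffunP => k; rewrite !ffunE !(inj_eq perm_inj).
Qed.

Lemma with_pairC (i j : 'I_K) (x y : R) (q : {ffun 'I_K -> R}) :
  i != j -> with_pair i j x y q = with_pair j i y x q.
Proof.
move=> ij; apply/ffunP => k; rewrite !ffunE.
by case: (eqVneq k i) => [->|//]; rewrite (negPf ij).
Qed.

Lemma symmetric_swap (i j : 'I_K) (x y : R) (q : {ffun 'I_K -> R}) :
  symmetric_rule f -> i != j -> 0 <= x <= 1 -> 0 <= y <= 1 -> in_cube q ->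
  f (with_pair i j x y q) i = f (with_pair i j y x q) j.
Proof.
move=> symf ij xP yP qP; rewrite (with_pairC y x q ij).
have := symmetric_with_pair (tperm i j) i j symf xP yP qP.
rewrite tpermL tpermR => <-; congr (f _ i); apply/ffunP => k; rewrite !ffunE.
by case: (eqVneq k i) => // ki; case: (eqVneq k j) => // kj; rewrite tpermD // eq_sym.
Qed.

(** By symmetry, what the first engine gets at (y, x) is what the second gets at (x, y). So
    cross-concavity compares the lower engine's gain with the higher engine's loss, both starting
    from one profile. *)
Lemma cross_concave_at (i j : 'I_K) (x y : R) (q : {ffun 'I_K -> R}) :
  symmetric_rule f -> strictly_cross_concave f -> i != j ->
  0 <= x <= 1 -> 0 <= y <= 1 -> x < y -> in_cube q ->
  exists2 delta : R, 0 < delta & forall e : R, 0 < e < delta ->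
    f (with_pair i j x y q) j - f (with_pair i j x (y - e) q) j <
    f (with_pair i j (x + e) y q) i - f (with_pair i j x y q) i.
Proof.
move=> symf ccf ij xP yP xy qP.
have K1 : (1 < K)%N by have := max_card [set i; j]; rewrite cards2 ij card_ord.
pose a := Ordinal (ltnW K1); pose b := Ordinal K1.
have [s sa sb] := perm_of_pair (isT : a != b) ij.
pose p := [ffun k => q (s k)].
have pP : in_cube p by move=> k; rewrite ffunE.
have [d d0 dP] := ccf a b erefl erefl x y p xP yP xy pP.
(* The bound [y - x] gives [x + e < y] and [x < y - e], which keeps both vectors in the cube, where
   symmetry applies. *)
exists (Num.min d (y - x)); first by rewrite lt_min d0 subr_gt0.
move=> e; rewrite lt_min => /and3P[e0 ed exy].
have xeP : 0 <= x + e <= 1 by lra.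
have yeP : 0 <= y - e <= 1 by lra.
have /dP : 0 < e < d by rewrite e0.
rewrite !(symmetric_with_pair s) // sa sb.
by rewrite (symmetric_swap symf ij yP xP qP) (symmetric_swap symf ij yeP xP qP).
Qed.

End Rule.

Section Game.
Variables (R : realType) (K N : nat) (gamma : {ffun 'I_N -> R}).
Variables (f : {ffun 'I_K -> R} -> {ffun 'I_K -> R}).
Variable Q : 'I_K -> {ffun 'I_N -> R}.

Lemma satisfaction_deviation (i j : 'I_K) (q : {ffun 'I_N -> R}) (t : 'I_N) :
  satisfaction [eta Q with i |-> q] t =
  with_pair i j (q t) (Q j t) (satisfaction Q t).
Proof.
apply/ffunP => k; rewrite !ffunE /=; case: (eqVneq k i) => // _.
by case: (eqVneq k j) => [->|].
Qed.

Lemma with_pair_satisfaction (i j : 'I_K) (t : 'I_N) :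
  with_pair i j (Q i t) (Q j t) (satisfaction Q t) = satisfaction Q t.
Proof.
apply/ffunP => k; rewrite !ffunE.
by case: (eqVneq k i) => [->|_] //; case: (eqVneq k j) => [->|].
Qed.

(** Moving mass [e] from page [m] to page [n] alters only two summands of the payoff, and at beta =
    1 the last factor of each is 1. *)
Lemma equilibrium_transfer (i j : 'I_K) (n m : 'I_N) (e : R) :
  pure_nash_equilibrium gamma f 1 Q -> m != n -> 0 <= e <= Q i m ->
  gamma n * (f (with_pair i j (Q i n + e) (Q j n) (satisfaction Q n)) i -
             f (satisfaction Q n) i) <=
  gamma m * (f (satisfaction Q m) i -
             f (with_pair i j (Q i m - e) (Q j m) (satisfaction Q m)) i).
Proof.
move=> [Qd Qopt] mn em.
have := Qopt i _ (transfer_distribution mn em (Qd i)).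
rewrite /payoff (bigD1 n) //= (bigD1 m) //= [leRHS](bigD1 n) //=.
rewrite [in leRHS](bigD1 m) //= !(satisfaction_deviation i j).
rewrite [X in _ + (_ + X) <= _ -> _](eq_bigr
  (fun t => gamma t * f (satisfaction Q t) i * (1 + (1 - 1) * Q i t))).
  by rewrite !ffunE !eqxx (negPf mn); lra.
move=> t /andP[/negPf tn /negPf tm].
by rewrite (satisfaction_deviation i j) eqxx !ffunE tn tm with_pair_satisfaction.
Qed.

End Game.

Theorem theorem4p1 (R : realType) (K N : nat) (gamma : {ffun 'I_N -> R})
    (f : {ffun 'I_K -> R} -> {ffun 'I_K -> R}) (Q : 'I_K -> {ffun 'I_N -> R}) :
  distribution gamma -> (forall n, 0 < gamma n) ->
  selection_rule f -> symmetric_rule f -> strictly_cross_concave f ->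
  pure_nash_equilibrium gamma f 1 Q ->
  forall i i' : 'I_K, Q i = Q i'.
Proof.
move=> _ gamma0 _ symf ccf eqQ i j; have [Qd _] := eqQ.
have [/eqP //|/eqP neqQ] := boolP (Q i == Q j).
have ij : i != j by apply: contra_notN neqQ => /eqP ->.
have ji : j != i by rewrite eq_sym.
have [n Qn] := distribution_ltP (Qd i) (Qd j) neqQ.
have [m Qm] := distribution_ltP (Qd j) (Qd i) (nesym neqQ).
have mn : m != n.
  by apply/eqP => mn; move: Qm; rewrite mn ltNge (ltW Qn).
have nm : n != m by rewrite eq_sym.
have QP k t : 0 <= Q k t <= 1.
  by rewrite (proj1 (Qd k)) distribution_le1.
have SP t : in_cube (satisfaction Q t) by move=> k; rewrite ffunE.
have [d d0 dP] := cross_concave_at symf ccf ij (QP i n) (QP j n) Qn (SP n).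
have [d' d'0 d'P] := cross_concave_at symf ccf ji (QP j m) (QP i m) Qm (SP m).
(* Engine [j] gives up mass on [n] and engine [i] on [m], hence the last two bounds; they are
   positive because [Q i n < Q j n] and [Q j m < Q i m]. Halving [r] makes every bound strict. *)
pose r := Num.min (Num.min d d') (Num.min (Q j n) (Q i m)).
have r0 : 0 < r.
  rewrite !lt_min d0 d'0 (le_lt_trans _ Qn) ?(le_lt_trans _ Qm) //.
    by case/andP: (QP j m).
  by case/andP: (QP i n).
have e0 : 0 < r / 2 by rewrite divr_gt0.
have : r / 2 < r by lra.
rewrite {2}/r !lt_min => /andP[/andP[ed ed'] /andP[en em]].
have := dP (r / 2); have := d'P (r / 2).
have := equilibrium_transfer (i := i) j eqQ mn (e := r / 2).
have := equilibrium_transfer (i := j) i eqQ nm (e := r / 2).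
rewrite !with_pair_satisfaction e0 ed ed' (ltW e0) (ltW en) (ltW em) /=.
rewrite !(with_pairC _ _ _ ji).
move=> /(_ isT) devj /(_ isT) devi /(_ isT) ccm /(_ isT) ccn.
(* In the notation of the overview, the cycle is gamma(n) A_n <= gamma(m) B_m < gamma(m) A_m <=
   gamma(n) B_n < gamma(n) A_n. *)
rewrite -(ltr_pM2l (gamma0 m)) in ccm; rewrite -(ltr_pM2l (gamma0 n)) in ccn.
by have := lt_le_trans (le_lt_trans devi ccm) (le_trans devj (ltW ccn)); rewrite ltxx.
Qed.
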